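(* Let $A=A_s+\epsilon A_i$ be a dual real matrix with $A_s,A_i\in\mathbb{R}^{m\times n}$, $m\ge n$, and $\operatorname{rank}(A_s)=k\le\min\{m,n\}$. Let $A_s=L_sU_s$ represent the LU decomposition of $A_s$, where $L_s\in\mathbb{R}^{m\times k}$ is a lower trapezoidal matrix with rank $k$, and $U_s\in\mathbb{R}^{k\times n}$ is an upper trapezoidal matrix with rank $k$. Then the following conditions are equivalent: (1) the dual Moore-Penrose generalized inverse (DMPGI) of $A$ exists; (2) the dual rank-$k$ decomposition of $A$ exists; (3) the DLU decomposition of $A$ exists; (4) $(I_m-L_sL_s^\dagger)A_i(I_n-U_s^\dagger U_s)=O_{m\times n}$.
   Context: A dual real matrix is a formal expression $A=A_s+\epsilon A_i$ with real matrices $A_s$ (standard part) and $A_i$ (infinitesimal part), where $\epsilon^2=0$ and $\epsilon$ commutes with everything; thus $(A_s+\epsilon A_i)(B_s+\epsilon B_i)=A_sB_s+\epsilon(A_sB_i+A_iB_s)$, and $A^\top=A_s^\top+\epsilon A_i^\top$. $M^\dagger$ is the Moore-Penrose pseudoinverse of a real matrix $M$. $I_m$ is the $m\times m$ identity matrix and $O_{m\times n}$ the $m\times n$ zero matrix. A matrix $M$ is lower (upper) trapezoidal if $M(i,j)=0$ whenever $j>i$ (respectively $i>j$); a dual matrix is lower (upper) trapezoidal if both its standard and infinitesimal parts are. DMPGI: the DMPGI of an $m\times n$ dual real matrix $A$ is an $n\times m$ dual real matrix $X$ with $AXA=A$, $XAX=X$, $AX=(AX)^\top$, $XA=(XA)^\top$.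 Dual rank-$k$ decomposition: a factorization $A=BC$ with $B$ an $m\times k$ and $C$ a $k\times n$ dual real matrix, both of full rank, meaning that their standard parts $B_s$ and $C_s$ have rank $k$. DLU decomposition: a factorization $A=LU$ where $L=L_s+\epsilon L_i$ is an $m\times k$ lower trapezoidal dual real matrix and $U=U_s+\epsilon U_i$ is a $k\times n$ upper trapezoidal dual real matrix, with standard parts the given $L_s$ and $U_s$.
   Formalization: The formal theorem also assumes L_s(j,j) ≠ 0 and U_s(j,j) ≠ 0 for all j < k; without this the claim is false, e.g. L_s = A_s = [0 0; 1 0; 0 1], U_s = I_2, A_i = E_12 satisfies (4) but not (3). *)

(* Defs.v *)
From HB Require Import structures.
From mathcomp Require Import all_boot all_order all_algebra.

Set Implicit Arguments.
Unset Strict Implicit.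
Unset Printing Implicit Defensive.

Import Order.TTheory GRing.Theory Num.Theory.
Local Open Scope ring_scope.

Definition lower_trapezoidal (R : pzRingType) m n (M : 'M[R]_(m, n)) : Prop :=
  forall (i : 'I_m) (j : 'I_n), (i < j)%N -> M i j = 0.

Definition upper_trapezoidal (R : pzRingType) m n (M : 'M[R]_(m, n)) : Prop :=
  forall (i : 'I_m) (j : 'I_n), (j < i)%N -> M i j = 0.

(* [A] stands for the formal expression dst A + epsilon * dinf A. *)
Record dualmx (R : pzRingType) (m n : nat) := DualMx {
  dst : 'M[R]_(m, n);
  dinf : 'M[R]_(m, n)
}.

Definition dual_mul (R : pzRingType) m n p
    (A : dualmx R m n) (B : dualmx R n p) : dualmx R m p :=
  DualMx (dst A *m dst B) (dst A *m dinf B + dinf A *m dst B).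

Definition dual_tr (R : pzRingType) m n (A : dualmx R m n) : dualmx R n m :=
  DualMx (dst A)^T (dinf A)^T.

Definition dual_lower_trapezoidal (R : pzRingType) m n (A : dualmx R m n) :=
  lower_trapezoidal (dst A) /\ lower_trapezoidal (dinf A).

Definition dual_upper_trapezoidal (R : pzRingType) m n (A : dualmx R m n) :=
  upper_trapezoidal (dst A) /\ upper_trapezoidal (dinf A).

Definition is_DMPGI (R : pzRingType) m n
    (A : dualmx R m n) (X : dualmx R n m) : Prop :=
  [/\ dual_mul (dual_mul A X) A = A,
      dual_mul (dual_mul X A) X = X,
      dual_mul A X = dual_tr (dual_mul A X) &
      dual_mul X A = dual_tr (dual_mul X A)].

Definition is_dual_rank_decomposition (R : fieldType) m n k
    (A : dualmx R m n) (B : dualmx R m k) (C : dualmx R k n) : Prop :=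
  [/\ A = dual_mul B C, \rank (dst B) = k & \rank (dst C) = k].

Definition is_DLU (R : pzRingType) m n k (Ls : 'M[R]_(m, k)) (Us : 'M[R]_(k, n))
    (A : dualmx R m n) (L : dualmx R m k) (U : dualmx R k n) : Prop :=
  [/\ A = dual_mul L U, dst L = Ls, dst U = Us,
      dual_lower_trapezoidal L & dual_upper_trapezoidal U].

Definition penrose (R : realFieldType) m n (M : 'M[R]_(m, n)) (X : 'M[R]_(n, m)) : bool :=
  [&& M *m X *m M == M, X *m M *m X == X,
      M *m X == (M *m X)^T & X *m M == (X *m M)^T].

Lemma row_mul_tr_eq0 (R : realFieldType) n (v : 'rV[R]_n) : v *m v^T = 0 -> v = 0.
Proof.
move=> /matrixP/(_ 0 0); rewrite !mxE => h.
have h2 : \sum_j (v 0 j) ^+ 2 = 0.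
  by rewrite -[RHS]h; apply: eq_bigr => j _; rewrite mxE expr2.
apply/rowP => j; rewrite !mxE; apply/eqP; rewrite -sqrf_eq0.
by move/eqP: h2; rewrite psumr_eq0 => [/allP/(_ j)/(_ (mem_index_enum _))/=|i _];
  rewrite ?sqr_ge0.
Qed.

Lemma gram_unit (R : realFieldType) k n (C : 'M[R]_(k, n)) : row_free C -> C *m C^T \in unitmx.
Proof.
move=> fC; rewrite -row_free_unit -kermx_eq0; apply/eqP/row_matrixP => i.
rewrite row0; set u := row i _.
have hu : u *m (C *m C^T) = 0 by rewrite -row_mul mulmx_ker row0.
have : u *m C = 0.
  by apply: row_mul_tr_eq0; rewrite trmx_mul mulmxA -[u *m C *m _]mulmxA hu mul0mx.
by move/eqP; rewrite mulmx_free_eq0 // => /eqP.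
Qed.

Lemma penrose_ex (R : realFieldType) m n (M : 'M[R]_(m, n)) :
  exists X, penrose M X.
Proof.
have [k [B [C [-> fB fC]]]] : exists k (B : 'M[R]_(m, k)) (C : 'M[R]_(k, n)),
    [/\ M = B *m C, row_full B & row_free C].
  exists (\rank M), (col_base M), (row_base M).
  by rewrite mulmx_base col_base_full row_base_free.
have uC : C *m C^T \in unitmx by apply: gram_unit.
have uB : B^T *m B \in unitmx.
  by rewrite -{2}[B]trmxK; apply: gram_unit; rewrite /row_free mxrank_tr.
pose GC := invmx (C *m C^T); pose GB := invmx (B^T *m B).
have sC : GC^T = GC by rewrite /GC trmx_inv trmx_mul trmxK.
have sB : GB^T = GB by rewrite /GB trmx_inv trmx_mul trmxK.
have cC : C *m C^T *m GC = 1%:M by rewrite mulmxV.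
have cB : GB *m (B^T *m B) = 1%:M by rewrite mulVmx.
exists (C^T *m GC *m (GB *m B^T)).
have MX : B *m C *m (C^T *m GC *m (GB *m B^T)) = B *m (GB *m B^T).
  by rewrite -!mulmxA; congr (_ *m _); rewrite !mulmxA cC mul1mx.
have XM : C^T *m GC *m (GB *m B^T) *m (B *m C) = C^T *m GC *m C.
  by rewrite mulmxA -(mulmxA _ _ B) -(mulmxA _ _ B) cB mulmx1.
rewrite /penrose MX XM; apply/and4P; split; apply/eqP.
- by rewrite mulmxA -(mulmxA _ _ B) -(mulmxA _ _ B) cB mulmx1.
- rewrite mulmxA; congr (_ *m _).
  by rewrite -(mulmxA _ C) mulmxA -!mulmxA (mulmxA C) cC mulmx1.
- by rewrite !trmx_mul trmxK sB mulmxA.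
- by rewrite !trmx_mul trmxK sC mulmxA.
Qed.

Definition mpinv (R : realFieldType) m n (M : 'M[R]_(m, n)) : 'M[R]_(n, m) :=
  xchoose (penrose_ex M).

Lemma mpinvP (R : realFieldType) m n (M : 'M[R]_(m, n)) : penrose M (mpinv M).
Proof. exact: xchooseP. Qed.

Lemma penrose_uniq (R : realFieldType) m n (M : 'M[R]_(m, n)) X Y :
  penrose M X -> penrose M Y -> X = Y.
Proof.
move=> /and4P[/eqP x1 /eqP x2 /eqP x3 /eqP x4].
move=> /and4P[/eqP y1 /eqP y2 /eqP y3 /eqP y4].
have e1 : M *m X = M *m Y.
  rewrite -{1}y1 -[M *m Y *m M *m X]mulmxA y3 x3 -trmx_mul.
  by rewrite mulmxA x1 -y3.
have e2 : X *m M = Y *m M.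
  have -> : X *m M = (X *m M) *m (Y *m M) by rewrite -mulmxA [M *m (Y *m M)]mulmxA y1.
  by rewrite x4 y4 -trmx_mul -mulmxA [M *m (X *m M)]mulmxA x1 -y4.
by rewrite -x2 e2 -mulmxA e1 mulmxA y2.
Qed.

(* Main.v *)
(* Condition (4) says exactly that [dinf A = Ls *m P + Q *m Us] for some [P] and
   [Q], which yields (2) at once.  For (3), [Z] is free in
   [dinf A = Ls *m (P + Z *m Us) + (Q - Ls *m Z) *m Us]: the strictly lower part
   of [Z] makes the first factor upper trapezoidal and, independently, its
   strictly upper part makes the second lower trapezoidal, by triangular
   substitution along the nonzero pivots.  For (1), with
   [M = dst A], [N = dinf A] and [Y] the Moore-Penrose inverse of [M], the
   infinitesimal part of the DMPGI is
   [- Y N Y + Y Y^T N^T (1 - M Y) + (1 - Y M) N^T Y^T Y]. *)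
Require Import Defs.
From mathcomp Require Import all_boot all_order all_algebra.
From mathcomp Require Import reals.
Import GRing.Theory Num.Theory.
Local Open Scope ring_scope.

Lemma sandwich_eq0 (R : pzRingType) (a b m n k l : nat)
    (E : 'M[R]_(a, m)) (F : 'M[R]_(n, b)) (L : 'M[R]_(m, k)) (U : 'M[R]_(l, n))
    (P : 'M[R]_(k, n)) (Q : 'M[R]_(m, l)) :
  E *m L = 0 -> U *m F = 0 -> E *m (L *m P + Q *m U) *m F = 0.
Proof.
move=> EL UF; rewrite mulmxDr mulmxDl !mulmxA EL !mul0mx add0r.
by rewrite -mulmxA UF mulmx0.
Qed.

(** A converse to [sandwich_eq0]: for [E = L *m L'] and [F = U' *m U] the two summands have the form
    [L *m P] and [Q *m U]. *)
Lemma mulmx_complE (R : pzRingType) (m n : nat) (E : 'M[R]_m) (F : 'M[R]_n)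
    (N : 'M[R]_(m, n)) :
  (1%:M - E) *m N *m (1%:M - F) = 0 -> N = E *m N + (1%:M - E) *m N *m F.
Proof.
rewrite mulmxBr mulmx1 => /eqP; rewrite subr_eq0 => /eqP <-.
by rewrite mulmxBl mul1mx addrC subrK.
Qed.

Lemma mulmx_row_free0 (R : fieldType) (m n p k : nat) (E : 'M[R]_(p, m))
    (B : 'M[R]_(m, k)) (C : 'M[R]_(k, n)) :
  \rank C = k -> E *m (B *m C) = 0 -> E *m B = 0.
Proof.
move=> rC /eqP; rewrite mulmxA mulmx_free_eq0; first by move/eqP.
by rewrite /row_free rC.
Qed.

Lemma mulmx_col_free0 (R : fieldType) (m n p k : nat) (F : 'M[R]_(n, p))
    (B : 'M[R]_(m, k)) (C : 'M[R]_(k, n)) :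
  \rank B = k -> B *m C *m F = 0 -> C *m F = 0.
Proof.
move=> rB /(congr1 trmx); rewrite !trmx_mul trmx0 => h.
apply: trmx_inj; rewrite trmx_mul trmx0.
by apply: mulmx_row_free0 h; rewrite mxrank_tr.
Qed.

(* The last pivot of [V] may vanish: it only multiplies the last column of [Z],
   which is zero, so it may be replaced by [1] to make [V] invertible. *)
Lemma strict_lower_solve (R : fieldType) (k : nat) (V P : 'M[R]_k) :
    upper_trapezoidal V -> (forall i : 'I_k, (i.+1 < k)%N -> V i i != 0) ->
  exists2 Z : 'M[R]_k, (forall i j : 'I_k, (i <= j)%N -> Z i j = 0) &
    upper_trapezoidal (P + Z *m V).
Proof.
move=> uV pV.
pose W : 'M[R]_k := \matrix_(i, j) if (i.+1 == k) && (i == j) then 1 else V i j.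
have uW : upper_trapezoidal W.
  move=> i j ltji; rewrite mxE -val_eqE /= [i == j :> nat]gtn_eqF // andbF.
  exact: uV.
have unitW : W \in unitmx.
  rewrite unitmxE -det_tr det_trig; last first.
    by apply/is_trig_mxP => i j ltij; rewrite mxE uW.
  rewrite unitfE; apply/prodf_neq0 => i _; rewrite !mxE eqxx andbT.
  case: ifP => [_|ni]; first exact: oner_neq0.
  by apply: pV; rewrite ltn_neqAle ni ltn_ord.
(* [S] solves [P + S *m W = 0]. Truncating it to [Z] leaves the residue [(Z - S) *m W], a product of
   two upper triangular matrices. *)
pose S := - (P *m invmx W).
pose Z : 'M[R]_k := \matrix_(i, j) if (j < i)%N then S i j else 0.
have ZE (i j : 'I_k) : (i <= j)%N -> Z i j = 0.
  by move=> leij; rewrite mxE ltnNge leij.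
exists Z => // i j ltji.
have ZV : Z *m V = Z *m W.
  apply/matrixP => a b; rewrite !mxE; apply: eq_bigr => c _.
  rewrite [W c b]mxE; case: eqP => //= ck.
  by rewrite ZE ?mul0r // -ltnS ck.
have -> : P = - (S *m W) by rewrite mulNmx mulmxKV // opprK.
rewrite ZV addrC -mulmxBl mxE big1 // => c _.
have [ltci|leic] := ltnP c i; first by rewrite !mxE ltci subrr mul0r.
by rewrite uW ?mulr0 // (leq_trans ltji).
Qed.

Lemma upper_trapezoidal_solve (R : fieldType) (k n : nat) (U P : 'M[R]_(k, n)) :
    (k <= n)%N -> upper_trapezoidal U ->
    (forall (i : 'I_k) (j : 'I_n), i = j :> nat -> (i.+1 < k)%N -> U i j != 0) ->
  exists2 Z : 'M[R]_k, (forall i j : 'I_k, (i <= j)%N -> Z i j = 0) &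
    upper_trapezoidal (P + Z *m U).
Proof.
move=> lekn uU pU; pose w := widen_ord lekn.
have [||Z sZ uZ] := @strict_lower_solve R k (colsub w U) (colsub w P).
- by move=> i j ltji; rewrite mxE uU.
- by move=> i lti; rewrite mxE pU.
exists Z => // i j ltji.
(* Below the diagonal [j < i < k], so only the leading square block matters. *)
have ltjk : (j < k)%N by apply: ltn_trans ltji (ltn_ord i).
have -> : j = w (Ordinal ltjk) by apply: val_inj.
rewrite -[RHS](uZ i (Ordinal ltjk) ltji) !mxE.
by congr (_ + _); apply: eq_bigr => c _; rewrite !mxE.
Qed.

Lemma lower_trapezoidal_solve (R : fieldType) (m k : nat) (L Q : 'M[R]_(m, k)) :
    (k <= m)%N -> lower_trapezoidal L ->
    (forall (i : 'I_m) (j : 'I_k), i = j :> nat -> (j.+1 < k)%N -> L i j != 0) ->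
  exists2 Z : 'M[R]_k, (forall i j : 'I_k, (j <= i)%N -> Z i j = 0) &
    lower_trapezoidal (Q - L *m Z).
Proof.
move=> lekm lL pL.
have [||Z sZ uZ] := @upper_trapezoidal_solve R k m L^T (- Q^T) lekm.
- by move=> i j ltji; rewrite mxE lL.
- by move=> i j eij lti; rewrite mxE pL.
exists Z^T => [i j leji|i j ltij]; first by rewrite mxE sZ.
have -> : Q - L *m Z^T = - (- Q^T + Z *m L^T)^T.
  by rewrite linearD linearN /= trmx_mul !trmxK opprD opprK.
by rewrite mxE mxE uZ // oppr0.
Qed.

Lemma trapezoidal_split (R : fieldType) (m n k : nat)
    (L Q : 'M[R]_(m, k)) (U P : 'M[R]_(k, n)) :
    (k <= m)%N -> (k <= n)%N -> lower_trapezoidal L -> upper_trapezoidal U ->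
    (forall (i : 'I_m) (j : 'I_k), i = j :> nat -> (j.+1 < k)%N -> L i j != 0) ->
    (forall (i : 'I_k) (j : 'I_n), i = j :> nat -> (i.+1 < k)%N -> U i j != 0) ->
  exists (L' : 'M[R]_(m, k)) (U' : 'M[R]_(k, n)),
    [/\ lower_trapezoidal L', upper_trapezoidal U' &
        L *m U' + L' *m U = L *m P + Q *m U].
Proof.
move=> lekm lekn lL uU pL pU.
have [Zl sZl uZl] := @upper_trapezoidal_solve R k n U P lekn uU pU.
have [Zu sZu lZu] := @lower_trapezoidal_solve R m k L Q lekm lL pL.
exists (Q - L *m (Zu + Zl)), (P + (Zl + Zu) *m U); split.
(* No interference: [L *m Zl] is lower trapezoidal since both factors are. Dually, [Zu *m U] is
   upper trapezoidal. *)
- move=> i j ltij; rewrite mulmxDr opprD addrA mxE lZu // add0r !mxE.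
  rewrite big1 ?oppr0 // => c _.
  have [leci|ltic] := leqP c i; last by rewrite lL ?mul0r.
  by rewrite sZl ?mulr0 // ltnW // (leq_ltn_trans leci).
- move=> i j ltji; rewrite mulmxDl addrA mxE uZl // add0r mxE.
  rewrite big1 // => c _.
  have [lecj|ltjc] := leqP c j; last by rewrite uU ?mulr0.
  by rewrite sZu ?mul0r // ltnW // (leq_ltn_trans lecj).
rewrite mulmxDr mulmxBl !mulmxA (addrC Zl) -addrA; congr (_ + _).
by rewrite addrC subrK.
Qed.

Lemma DMPGI_sufficient (R : realFieldType) (m n : nat) (A : dualmx R m n)
    (Y : 'M[R]_(n, m)) :
    penrose (dst A) Y ->
    (1%:M - dst A *m Y) *m dinf A *m (1%:M - Y *m dst A) = 0 ->
  exists X : dualmx R n m, is_DMPGI A X.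
Proof.
case: A => M N /= /and4P[/eqP MYM /eqP YMY /eqP sE /eqP sF].
move eE: (M *m Y) MYM sE => E MYM sE; move eF: (Y *m M) YMY sF => F YMY sF hN.
have YYM : Y^T *m F = Y^T by rewrite sF -trmx_mul YMY.
have MYY : E *m Y^T = Y^T by rewrite sE -trmx_mul -eE mulmxA eF YMY.
have sE' : (1%:M - E)^T = 1%:M - E by rewrite linearB /= trmx1 -sE.
have sF' : (1%:M - F)^T = 1%:M - F by rewrite linearB /= trmx1 -sF.
have EM : (1%:M - E) *m M = 0 by rewrite mulmxBl mul1mx MYM subrr.
have MF : M *m (1%:M - F) = 0 by rewrite mulmxBr mulmx1 -eF mulmxA eE MYM subrr.
have FF : F *m (1%:M - F) = 0 by rewrite -{1}eF -mulmxA MF mulmx0.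
have FY : (1%:M - F) *m Y = 0 by rewrite mulmxBl mul1mx YMY subrr.
(* [Xi] is arranged so that [A X] and [X A] have infinitesimal parts [G + G^T] and [H + H^T], which
   are visibly symmetric. *)
pose G := (1%:M - E) *m N *m Y; pose H := Y *m N *m (1%:M - F).
have GT : G^T = Y^T *m N^T *m (1%:M - E) by rewrite !trmx_mul sE' mulmxA.
have HT : H^T = (1%:M - F) *m N^T *m Y^T by rewrite !trmx_mul sF' mulmxA.
pose Xi := - (Y *m N *m Y) + Y *m G^T + H^T *m Y.
have AXi : M *m Xi + N *m Y = G + G^T.
  rewrite /Xi !mulmxDr mulmxN GT HT !mulmxA MF !mul0mx addr0 eE MYY.
  by rewrite /G !mulmxBl mul1mx addrAC [- _ + _]addrC.
have XAi : Y *m N + Xi *m M = H + H^T.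
  rewrite /Xi !mulmxDl mulNmx GT HT -!mulmxA EM !mulmx0 addr0 eF YYM.
  by rewrite /H mulmxBr mulmx1 !mulmxA addrA.
exists (DualMx Y Xi); rewrite /is_DMPGI /dual_mul /dual_tr /= eE eF.
rewrite AXi XAi; split; congr DualMx => //.
(* Since [G^T *m M = 0], what remains is [E *m N + (1 - E) *m N *m F], which is [N] by [hN]. *)
- rewrite mulmxDl GT -(mulmxA (_ *m N^T)) EM mulmx0 addr0 -mulmxA eF.
  by rewrite -mulmx_complE.
- rewrite mulmxDl -(mulmxA (Y *m N)) FY mulmx0 add0r.
  by rewrite /Xi !mulmxDr mulmxN HT !mulmxA FF !mul0mx addr0 YMY.
- by rewrite linearD /= trmxK addrC.
- by rewrite linearD /= trmxK addrC.
Qed.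

(* [pivLs] and [pivUs]: the given LU decomposition is regular, i.e. its pivots
   do not vanish (the last pivot is left unconstrained). *)
Theorem theorem4p2 (R : realType) (m n k : nat)
    (A : dualmx R m n) (Ls : 'M[R]_(m, k)) (Us : 'M[R]_(k, n))
    (le_nm : (n <= m)%N)
    (rankA : \rank (dst A) = k) (le_k : (k <= minn m n)%N)
    (defA : dst A = Ls *m Us)
    (lowLs : lower_trapezoidal Ls) (rankLs : \rank Ls = k)
    (uppUs : upper_trapezoidal Us) (rankUs : \rank Us = k)
    (pivLs : forall (i : 'I_m) (j : 'I_k),
       i = j :> nat -> (j.+1 < k)%N -> Ls i j != 0)
    (pivUs : forall (i : 'I_k) (j : 'I_n),
       i = j :> nat -> (i.+1 < k)%N -> Us i j != 0) :
  [<-> exists X : dualmx R n m, is_DMPGI A X;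
       exists (B : dualmx R m k) (C : dualmx R k n),
         is_dual_rank_decomposition A B C;
       exists (L : dualmx R m k) (U : dualmx R k n), is_DLU Ls Us A L U;
       (1%:M - Ls *m mpinv Ls) *m dinf A *m (1%:M - mpinv Us *m Us) = 0].
Proof.
have [lekm lekn] : (k <= m)%N /\ (k <= n)%N by apply/andP; rewrite -leq_min.
have kerL : (1%:M - Ls *m mpinv Ls) *m Ls = 0.
  have /and4P[/eqP LXL _ _ _] := mpinvP Ls.
  by rewrite mulmxBl mul1mx LXL subrr.
have kerU : Us *m (1%:M - mpinv Us *m Us) = 0.
  have /and4P[/eqP UXU _ _ _] := mpinvP Us.
  by rewrite mulmxBr mulmx1 mulmxA UXU subrr.
have kerAl : (1%:M - Ls *m mpinv Ls) *m dst A = 0.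
  by rewrite defA mulmxA kerL mul0mx.
have kerAr : dst A *m (1%:M - mpinv Us *m Us) = 0.
  by rewrite defA -mulmxA kerU mulmx0.
have split4 : (1%:M - Ls *m mpinv Ls) *m dinf A *m (1%:M - mpinv Us *m Us) = 0 ->
    exists (P : 'M[R]_(k, n)) (Q : 'M[R]_(m, k)), dinf A = Ls *m P + Q *m Us.
  move/mulmx_complE => ->.
  exists (mpinv Ls *m dinf A), ((1%:M - Ls *m mpinv Ls) *m dinf A *m mpinv Us).
  by rewrite !mulmxA.
tfae.
- case=> X [/(congr1 (@dinf _ _ _)) /= AXA _ _ _].
  (* The infinitesimal part of [A X A = A] writes [dinf A] as [dst A *m _ + _ *m dst A], and the
     projectors in (4) kill [dst A]. *)
  have [|P [Q defN]] := split4.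
    by rewrite -AXA -[dst A *m _ *m _]mulmxA; apply: sandwich_eq0.
  exists (DualMx Ls Q), (DualMx Us P); split=> //.
  by rewrite /dual_mul /= -defA -defN; case: (A).
- case=> B [C [AE rB rC]].
  have defN : dinf A = dst B *m dinf C + dinf B *m dst C by rewrite AE.
  (* The projectors kill [dst A = dst B *m dst C]. Cancelling a factor of full rank, they kill
     [dst B] and [dst C]. *)
  have [|P [Q {}defN]] := split4.
    rewrite defN; apply: sandwich_eq0.
      by apply: (mulmx_row_free0 _ _ _ _ _ _ _ _ rC); move: kerAl; rewrite AE.
    by apply: (mulmx_col_free0 _ _ _ _ _ _ _ _ rB); move: kerAr; rewrite AE.
  have [Li [Ui [lLi uUi LUE]]] :=
    trapezoidal_split _ _ _ _ Ls Q Us P lekm lekn lowLs uppUs pivLs pivUs.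
  exists (DualMx Ls Li), (DualMx Us Ui); split=> //.
  by rewrite /dual_mul /= LUE -defA -defN; case: (A).
- case=> L [U [-> eL eU _ _]]; rewrite /= eL eU.
  exact: sandwich_eq0.
- case/split4 => P [Q defN].
  have pA := mpinvP (dst A); apply: DMPGI_sufficient pA _.
  have /and4P[/eqP AYA _ _ _] := mpinvP (dst A).
  (* The same cancellation in [dst A = Ls *m Us] shows that the projectors built from
     [mpinv (dst A)] kill [Ls] and [Us]. *)
  rewrite defN; apply: sandwich_eq0.
    apply: (mulmx_row_free0 _ _ _ _ _ _ _ _ rankUs).
    by rewrite -defA mulmxBl mul1mx AYA subrr.
  apply: (mulmx_col_free0 _ _ _ _ _ _ _ _ rankLs).
  by rewrite -defA mulmxBr mulmx1 mulmxA AYA subrr.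
Qed.
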